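(* Let $r$ be a positive integer, let $(G,v)$ be a based graph, and let $\Gamma$ be a subgroup of $\pi_1^r(G,v)$. Then there is a basepoint preserving $r$-covering map $p_\Gamma:(G_\Gamma,v_\Gamma)\to(G,v)$ with $G_\Gamma$ connected such that $p_{\Gamma*}(\pi_1^r(G_\Gamma,v_\Gamma))=\Gamma$. Moreover, such an $r$-covering is unique up to isomorphism (basepoint preserving isomorphism of graphs compatible with the projections to $(G,v)$).
   Context: A graph is a pair $G=(V(G),E(G))$ with $V(G)$ a set (possibly infinite) and $E(G)\subset V(G)\times V(G)$ a symmetric subset (loops allowed, no multiple edges). A graph homomorphism is a map of vertex sets sending edges to edges. A based graph $(G,v)$ is a graph with a chosen vertex $v$. A graph is connected if any two vertices are joined by a path. $r$-fundamental group. $L_n$ ($n\ge 0$) is the graph with $V(L_n)=\{0,1,\dots,n\}$ and $E(L_n)=\{(x,y): |x-y|=1\}$. A path of length $n$ in $G$ is a graph homomorphism $\varphi:L_n\to G$; write $l(\varphi)=n$; it joins $\varphi(0)$ to $\varphi(n)$. On the set of paths joining $v$ to $w$, let $\simeq_r$ be the equivalence relation generated by the following two conditions on a pair $\varphi,\psi$: (A) $l(\psi)=l(\varphi)+2$ and there is $x\in\{0,\dots,l(\varphi)\}$ with $\psi(i)=\varphi(i)$ for $i\le x$ and $\psi(i+2)=\varphi(i)$ for $i\ge x$; (B)$_r$ $l(\varphi)=l(\psi)$ and $\#\{i: 0\le i\le l(\varphi),\ \varphi(i)\ne\psi(i)\}<r$. $\pi_1^r(G,v)$ is the set of $\simeq_r$-classes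 $[\varphi]_r$ of paths from $v$ to $v$, with group operation induced by concatenation, $[\psi]_r\cdot[\varphi]_r=[\psi\cdot\varphi]_r$ ($\varphi$ followed by $\psi$). A based graph homomorphism $f$ induces $f_*:[\varphi]_r\mapsto[f\circ\varphi]_r$. $r$-coverings. $N(v)$ is the set of vertices adjacent to $v$; $N_0(v)=\{v\}$ and $N_i(v)=\bigcup_{w\in N_{i-1}(v)}N(w)$. A graph homomorphism $p:G\to H$ is an $r$-covering map if $p|_{N_i(v)}:N_i(v)\to N_i(p(v))$ is a bijection for every $1\le i\le r$ and every vertex $v$ of $G$. *)

(* Defs.v *)
From HB Require Import structures.
From Stdlib Require Import Relation_Operators.
From mathcomp Require Import all_boot all_order all_algebra.
From mathcomp Require Import all_classical zify.

Set Implicit Arguments.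
Unset Strict Implicit.
Unset Printing Implicit Defensive.

Local Open Scope nat_scope.
Local Open Scope classical_set_scope.
Local Open Scope quotient_scope.

Record graph := Graph {
  vertex :> Type;
  adj : vertex -> vertex -> Prop;
  adj_sym : forall x y, adj x y -> adj y x }.

Record graph_hom (G H : graph) := GraphHom {
  hom_fun :> G -> H;
  hom_adj : forall x y, adj x y -> adj (hom_fun x) (hom_fun y) }.

Definition hom_comp (G H K : graph) (g : graph_hom H K) (f : graph_hom G H) :
    graph_hom G K :=
  GraphHom (fun x y xy => hom_adj g (hom_adj f xy)).

Definition is_graph_iso (G H : graph) (f : graph_hom G H) : Prop :=
  exists g : graph_hom H G, cancel f g /\ cancel g f.

Record based_hom (G H : graph) (v : G) (w : H) := BasedHom {
  based_hom_hom :> graph_hom G H;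
  based_homE : based_hom_hom v = w }.

Lemma line_adj_sym n (x y : 'I_n.+1) :
  `|(x : int) - (y : int)|%N = 1 -> `|(y : int) - (x : int)|%N = 1.
Proof. by rewrite distnC. Qed.

Definition line (n : nat) : graph :=
  @Graph 'I_n.+1 (fun x y => `|(x : int) - (y : int)|%N = 1) (@line_adj_sym n).

Record gpath (G : graph) (v w : G) := GPath {
  plen : nat;
  pmap : graph_hom (line plen) G;
  pmap_start : pmap ord0 = v;
  pmap_end : pmap ord_max = w }.

(* [phi i] is only meaningful for [i <= plen phi]; beyond, [inord] is a
   default index. *)
Definition gpath_at (G : graph) (v w : G) (phi : gpath v w) (i : nat) : G :=
  pmap phi (inord i).
Coercion gpath_at : gpath >-> Funclass.

Section PathTheory.
Variable G : graph.
Implicit Types u v w : G.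

Lemma gpath_ext v w (phi psi : gpath v w) : plen phi = plen psi ->
  (forall i, i <= plen phi -> phi i = psi i) -> phi = psi.
Proof.
case: phi psi => [n [f hf] f0 fn] [m [g hg] g0 gm] /= nm.
case: m / nm g hg g0 gm => g hg g0 gm; rewrite /gpath_at /= => fg.
have E : f = g.
  by apply/funext => i; have := fg i (ltn_ord i); rewrite /= inord_val.
case: g / E hg g0 gm {fg} => hg g0 gm.
case: hg / (Prop_irrelevance hf hg) g0 gm => g0 gm.
by rewrite (Prop_irrelevance f0 g0) (Prop_irrelevance fn gm).
Qed.

Lemma gpath_at0 v w (phi : gpath v w) : phi 0 = v.
Proof.
rewrite /gpath_at -[RHS](pmap_start phi); congr (pmap _ _).
by apply/val_inj; rewrite /= inordK.
Qed.

Lemma gpath_at_len v w (phi : gpath v w) : phi (plen phi) = w.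
Proof.
rewrite /gpath_at -[RHS](pmap_end phi); congr (pmap _ _).
by apply/val_inj; rewrite /= inordK.
Qed.

Lemma gpath_adj v w (phi : gpath v w) i :
  i < plen phi -> adj (phi i) (phi i.+1).
Proof. by move=> ip; apply: hom_adj => /=; rewrite !inordK; lia. Qed.

Section Mk.
Variables (v w : G) (n : nat) (f : nat -> G).
Hypotheses (fS : forall i, i < n -> adj (f i) (f i.+1)).
Hypotheses (f0 : f 0 = v) (fn : f n = w).

Lemma mk_gpath_adj (x y : line n) : adj x y ->
  adj (f (nat_of_ord x)) (f (nat_of_ord y)).
Proof.
case: x y => [x xn] [y yn] /= xy.
have [yE|xE] : y = x.+1 \/ x = y.+1 by lia.
  by rewrite yE; apply: fS; lia.
by rewrite xE; apply/adj_sym/fS; lia.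
Qed.

Definition mk_gpath : gpath v w :=
  @GPath G v w n (@GraphHom (line n) G (fun x => f (nat_of_ord x)) mk_gpath_adj)
    f0 fn.

Lemma mk_gpathE i : i <= n -> mk_gpath i = f i.
Proof. by move=> ni; rewrite /gpath_at /= inordK. Qed.

End Mk.

Lemma gpath1_adj v i : i < 0 -> adj v v. Proof. by []. Qed.
Definition gpath1 v : gpath v v :=
  @mk_gpath v v 0 (fun=> v) (@gpath1_adj v) erefl erefl.

(* Composition order: [gcat psi phi] runs along [phi], then along [psi]. *)
Section Cat.
Variables (u v w : G) (psi : gpath v w) (phi : gpath u v).

Definition gcat_fun i := if i <= plen phi then phi i else psi (i - plen phi).

Lemma gcat_funr i : gcat_fun (plen phi + i) = psi i.
Proof.
rewrite /gcat_fun; case: ifP => [|_]; last by congr (psi _); lia.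
rewrite -{2}[plen phi]addn0 leq_add2l leqn0 => /eqP ->.
by rewrite addn0 gpath_at_len gpath_at0.
Qed.

Lemma gcat_adj i : i < plen phi + plen psi ->
  adj (gcat_fun i) (gcat_fun i.+1).
Proof.
move=> ilt; case: (ltnP i (plen phi)) => h.
  by rewrite /gcat_fun h (ltnW h); exact: gpath_adj.
rewrite -(subnKC h) -addnS !gcat_funr; apply: gpath_adj; lia.
Qed.

Lemma gcat_start : gcat_fun 0 = u. Proof. exact: gpath_at0. Qed.
Lemma gcat_end : gcat_fun (plen phi + plen psi) = w.
Proof. by rewrite gcat_funr gpath_at_len. Qed.

Definition gcat : gpath u w := mk_gpath gcat_adj gcat_start gcat_end.

Lemma gcatl i : i <= plen phi -> gcat i = phi i.
Proof. by move=> h; rewrite mk_gpathE /gcat_fun ?h //; lia. Qed.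

Lemma gcatr i : i <= plen psi -> gcat (plen phi + i) = psi i.
Proof. by move=> h; rewrite mk_gpathE ?gcat_funr //; lia. Qed.

Lemma gcatr_sub i : plen phi <= i <= plen phi + plen psi ->
  gcat i = psi (i - plen phi).
Proof. by move=> h; rewrite -gcatr; [congr (gcat _)|]; lia. Qed.
End Cat.

Section Rev.
Variables (v w : G) (phi : gpath v w).
Lemma grev_adj i : i < plen phi ->
  adj (phi (plen phi - i)) (phi (plen phi - i.+1)).
Proof.
move=> h; apply: adj_sym; have -> : plen phi - i = (plen phi - i.+1).+1 by lia.
by apply: gpath_adj; lia.
Qed.
Lemma grev_start : phi (plen phi - 0) = w.
Proof. by rewrite subn0 gpath_at_len. Qed.
Lemma grev_end : phi (plen phi - plen phi) = v.
Proof. by rewrite subnn gpath_at0. Qed.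
Definition grev : gpath w v :=
  @mk_gpath w v (plen phi) (fun i => phi (plen phi - i))
    grev_adj grev_start grev_end.
Lemma grevE i : i <= plen phi -> grev i = phi (plen phi - i).
Proof. by move=> h; rewrite mk_gpathE. Qed.
End Rev.

Definition gconnected : Prop := forall v w, inhabited (gpath v w).

End PathTheory.

Section PathMap.
Variables (G H : graph) (v w : G) (v' w' : H) (f : graph_hom G H).
Hypotheses (fv : f v = v') (fw : f w = w').
Definition gpath_map (phi : gpath v w) : gpath v' w' :=
  @GPath H v' w' (plen phi) (hom_comp f (pmap phi))
    (etrans (congr1 f (pmap_start phi)) fv)
    (etrans (congr1 f (pmap_end phi)) fw).
End PathMap.

Section Equiv.
Variables (G : graph) (r : nat).

Definition condA (v w : G) (phi psi : gpath v w) : Prop :=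
  plen psi = plen phi + 2 /\
  exists2 x, x <= plen phi &
    (forall i, i <= x -> psi i = phi i) /\
    (forall i, x <= i <= plen phi -> psi (i + 2) = phi i).

Definition condB (v w : G) (phi psi : gpath v w) : Prop :=
  plen phi = plen psi /\
  #|[pred i : 'I_(plen phi).+1 | `[< phi i <> psi i >]]| < r.

Definition req (v w : G) : gpath v w -> gpath v w -> Prop :=
  clos_refl_sym_trans (gpath v w) (fun phi psi => condA phi psi \/ condB phi psi).

Definition reqb (v w : G) : rel (gpath v w) := fun phi psi => `[< req phi psi >].

Lemma reqb_refl (v w : G) : reflexive (@reqb v w).
Proof. by move=> phi; apply/asboolP/rst_refl. Qed.
Lemma reqb_sym (v w : G) : symmetric (@reqb v w).
Proof. by move=> phi psi; apply/asboolP/asboolP; exact: rst_sym. Qed.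
Lemma reqb_trans (v w : G) : transitive (@reqb v w).
Proof.
by move=> psi phi chi /asboolP h /asboolP k; apply/asboolP; apply: rst_trans k.
Qed.

End Equiv.

HB.instance Definition _ (G : graph) (v w : G) := gen_eqMixin (gpath v w).
HB.instance Definition _ (G : graph) (v w : G) := gen_choiceMixin (gpath v w).

Canonical req_equiv (G : graph) (r : nat) (v w : G) :=
  EquivRel (@reqb G r v w) (@reqb_refl G r v w) (@reqb_sym G r v w)
    (@reqb_trans G r v w).

Section Congruence.
Variables (G : graph) (r : nat).
Implicit Types u v w : G.

Lemma req_morph (H : graph) (u v : G) (w z : H) (F : gpath u v -> gpath w z) :
  (forall phi psi, condA phi psi -> condA (F phi) (F psi)) ->
  (forall phi psi, condB r phi psi -> condB r (F phi) (F psi)) ->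
  forall phi psi, req r phi psi -> req r (F phi) (F psi).
Proof.
move=> FA FB phi psi; elim=> {phi psi}.
- by move=> a b [/FA|/FB] h; apply: rst_step; [left|right].
- by move=> a; exact: rst_refl.
- by move=> a b _; exact: rst_sym.
- by move=> a b c _ h _ k; exact: rst_trans h k.
Qed.

Lemma condB_inj (H : graph) (u v : G) (w z : H)
    (phi psi : gpath u v) (phi' psi' : gpath w z)
    (g : nat -> nat) : condB r phi psi -> plen phi' = plen psi' ->
  (forall i, i <= plen phi' -> phi' i <> psi' i ->
     g i <= plen phi /\ phi (g i) <> psi (g i)) ->
  (forall i j, i <= plen phi' -> j <= plen phi' ->
     phi' i <> psi' i -> phi' j <> psi' j -> g i = g j -> i = j) ->
  condB r phi' psi'.
Proof.
move=> [_ rlt] e' gP ginj; split=> //; apply: leq_ltn_trans rlt.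
pose h (i : 'I_(plen phi').+1) : 'I_(plen phi).+1 := inord (g i).
have hE i : phi' (nat_of_ord i) <> psi' (nat_of_ord i) ->
    nat_of_ord (h i) = g i.
  by move=> di; rewrite /h inordK // ltnS; case: (gP i (ltn_ord i) di).
rewrite -[X in X <= _](@card_in_image _ _ h); last first.
  move=> i j /asboolP di /asboolP dj /(congr1 (@nat_of_ord _)).
  rewrite !hE // => gij; apply: val_inj => /=.
  by apply: ginj => //; exact: (ltn_ord (_ : 'I_(plen phi').+1)).
apply: subset_leq_card; apply/fintype.subsetP => y /fintype.imageP[i /asboolP di ->].
by apply/asboolP; rewrite hE //; case: (gP i (ltn_ord i) di).
Qed.

Lemma req_gcatl u v w (psi : gpath v w) (phi phi' : gpath u v) :
  req r phi phi' -> req r (gcat psi phi) (gcat psi phi').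
Proof.
apply: (req_morph (F := gcat psi)) => {phi phi'} phi phi'.
- move=> [len [x xle [h1 h2]]]; split; first by rewrite /= len; lia.
  exists x; first by rewrite /=; lia.
  split=> i.
    by move=> ix; rewrite !gcatl ?h1 //; lia.
  move=> /= ix; have [ile|ilt] := leqP i (plen phi).
    by rewrite !gcatl ?h2 //; lia.
  by rewrite !gcatr_sub; [congr (psi _)|..]; lia.
- move=> B; have len := B.1.
  apply: (condB_inj (g := id) B) => //=; first by rewrite len.
  move=> i ile; have [ilt|igt] := leqP i (plen phi).
    by rewrite !gcatl -?len.
  by rewrite !gcatr_sub -?len; lia || case.
Qed.

Lemma req_gcatr u v w (psi psi' : gpath v w) (phi : gpath u v) :
  req r psi psi' -> req r (gcat psi phi) (gcat psi' phi).
Proof.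
apply: (@req_morph _ _ _ _ _ (fun x => gcat x phi)) => {psi psi'} psi psi'.
- move=> [len [x xle [h1 h2]]]; split; first by rewrite /= len; lia.
  exists (plen phi + x); first by rewrite /=; lia.
  split=> i.
    move=> ix; have [ile|ilt] := leqP i (plen phi); first by rewrite !gcatl.
    by rewrite !gcatr_sub ?h1 //; lia.
  move=> /= ix; rewrite !gcatr_sub; try lia.
  by rewrite -h2; [congr (psi' _)|]; lia.
- move=> B; have len := B.1.
  apply: (condB_inj (g := fun i => i - plen phi) B) => /=; first by rewrite len.
    move=> i ile; have [ilt|igt] := leqP i (plen phi).
      by rewrite !gcatl // => /(_ erefl).
    by rewrite !gcatr_sub; try lia; move=> d; split=> //; lia.
  move=> i j ile jle; have [ilt|igt] := leqP i (plen phi).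
    by rewrite !(gcatl _ ilt) => /(_ erefl).
  have [jlt|jgt] := leqP j (plen phi); last by move=> _ _; lia.
  by rewrite !(gcatl _ jlt) => _ /(_ erefl).
Qed.

Lemma req_grev v w (phi psi : gpath v w) :
  req r phi psi -> req r (grev phi) (grev psi).
Proof.
apply: (req_morph (F := @grev G v w)) => {phi psi} phi psi.
- move=> [len [x xle [h1 h2]]]; split; first by rewrite /= len.
  exists (plen phi - x); first by rewrite /=; lia.
  split=> i /= ix; rewrite !grevE ?len; try lia.
    by rewrite -h2; [congr (psi _)|]; lia.
  by rewrite -h1; [congr (psi _)|]; lia.
- move=> B; have len := B.1.
  apply: (condB_inj (g := fun i => plen phi - i) B) => //= i.
    by move=> ile; rewrite !grevE -?len // => d; split=> //; lia.
  by move=> j; lia.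
Qed.

Lemma gcatA u v w z (chi : gpath w z) (psi : gpath v w) (phi : gpath u v) :
  gcat chi (gcat psi phi) = gcat (gcat chi psi) phi.
Proof.
apply: gpath_ext => /= [|i ile]; first by lia.
have [h|h] := leqP i (plen phi).
  by rewrite !gcatl //=; lia.
rewrite [RHS]gcatr_sub /=; last by lia.
have [k|k] := leqP i (plen phi + plen psi).
  rewrite gcatl //= [RHS]gcatl; last by lia.
  by rewrite gcatr_sub //; lia.
by rewrite !gcatr_sub /=; [congr (chi _)|..] => /=; lia.
Qed.

Lemma gcat1g v w (phi : gpath v w) : gcat (gpath1 w) phi = phi.
Proof. by apply: gpath_ext => /= [|i ile]; [|rewrite gcatl //]; lia. Qed.

Lemma gcatg1 v w (phi : gpath v w) : gcat phi (gpath1 v) = phi.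
Proof.
apply: gpath_ext => //= i ile.
by rewrite gcatr_sub /=; [congr (phi _)|]; lia.
Qed.

Lemma grevK v w (phi : gpath v w) : grev (grev phi) = phi.
Proof.
apply: gpath_ext => //= i ile.
by rewrite !grevE /=; [congr (phi _)|..]; lia.
Qed.

Section There.
Variables (v w : G) (phi : gpath v w).
Variable k : nat.
Hypothesis kle : k <= plen phi.
Let f i := phi (if i <= k then i else k.*2 - i).
Lemma there_adj i : i < k.*2 -> adj (f i) (f i.+1).
Proof.
rewrite /f; have [h|h] := leqP i k; have [h'|h'] := leqP i.+1 k; try lia.
- by move=> _; apply: gpath_adj; lia.
- move=> ?; have -> : i = (k.*2 - i.+1).+1 by lia.
  apply/adj_sym; have -> : k.*2 - (k.*2 - i.+1).+2 = k.*2 - i.+1 - 0 by lia.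
  by rewrite subn0; apply: gpath_adj; lia.
- move=> ?; have -> : k.*2 - i = (k.*2 - i.+1).+1 by lia.
  by apply/adj_sym/gpath_adj; lia.
Qed.
Lemma there_start : f 0 = v. Proof. exact: gpath_at0. Qed.
Lemma there_end : f k.*2 = v.
Proof. by rewrite -[RHS](gpath_at0 phi) /f; congr (phi _); case: ifP; lia. Qed.
(* Along [phi] up to step [k], then back. *)
Definition there := mk_gpath there_adj there_start there_end.
Lemma thereE i : i <= k.*2 -> there i = phi (if i <= k then i else k.*2 - i).
Proof. exact: mk_gpathE. Qed.
End There.

Lemma req_there v w (phi : gpath v w) k (kle : k <= plen phi) :
  req r (there kle) (gpath1 v).
Proof.
elim: k => [|k IH] in kle *.
  rewrite (_ : there kle = gpath1 v); first exact: rst_refl.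
  apply: gpath_ext => // i /=; rewrite double0 leqn0 => /eqP->.
  by rewrite !gpath_at0.
have kle' : k <= plen phi by lia.
apply: rst_trans (IH kle'); apply/rst_sym/rst_step; left; split => /=.
  by lia.
exists k; first by lia.
split=> i h; rewrite !thereE /=; try lia.
  by congr (phi _); do 2 case: ifP; lia.
by congr (phi _); do 2 case: ifP; lia.
Qed.

Lemma req_gcatVg v w (phi : gpath v w) : req r (gcat (grev phi) phi) (gpath1 v).
Proof.
have -> : gcat (grev phi) phi = there (leqnn (plen phi)).
  apply: gpath_ext => /= [|i ile]; first by lia.
  rewrite thereE; last by lia.
  have [h|h] := leqP i (plen phi); first by rewrite gcatl.
  by rewrite gcatr_sub ?grevE /=; [congr (phi _)|..] => /=; lia.
exact: req_there.
Qed.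

End Congruence.

Section Pi1.
Variables (G : graph) (r : nat) (v : G).

Definition pi1 : Type := {eq_quot req_equiv r v v}.
HB.instance Definition _ := Choice.on pi1.
HB.instance Definition _ := EqQuotient.on pi1.

Definition pi1_class (phi : gpath v v) : pi1 := \pi_pi1 phi.

Lemma pi1_classP phi psi : pi1_class phi = pi1_class psi <-> req r phi psi.
Proof.
split=> [/eqP|h]; first by rewrite /pi1_class eqquotE => /asboolP.
by apply/eqP; rewrite /pi1_class eqquotE; apply/asboolP.
Qed.

Lemma pi1_class_repr (c : pi1) : pi1_class (repr c) = c.
Proof. exact: reprK. Qed.

Lemma pi1_ind (P : pi1 -> Prop) : (forall phi, P (pi1_class phi)) -> forall c, P c.
Proof. by move=> h c; rewrite -(pi1_class_repr c). Qed.

Lemma req_repr phi : req r (repr (pi1_class phi)) phi.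
Proof. by apply/pi1_classP; rewrite pi1_class_repr. Qed.

Definition pi1_one : pi1 := pi1_class (gpath1 v).
Definition pi1_mul (c d : pi1) : pi1 := pi1_class (gcat (repr c) (repr d)).
Definition pi1_inv (c : pi1) : pi1 := pi1_class (grev (repr c)).

Lemma pi1_mulE psi phi :
  pi1_mul (pi1_class psi) (pi1_class phi) = pi1_class (gcat psi phi).
Proof.
apply/pi1_classP; apply: rst_trans (req_gcatl _ (req_repr _)) _.
exact/req_gcatr/req_repr.
Qed.

Lemma pi1_invE phi : pi1_inv (pi1_class phi) = pi1_class (grev phi).
Proof. exact/pi1_classP/req_grev/req_repr. Qed.

Lemma pi1_mulA : associative pi1_mul.
Proof.
by elim/pi1_ind=> a; elim/pi1_ind=> b; elim/pi1_ind=> c; rewrite !pi1_mulE gcatA.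
Qed.
Lemma pi1_mul1 : left_id pi1_one pi1_mul.
Proof. by elim/pi1_ind=> a; rewrite pi1_mulE gcat1g. Qed.
Lemma pi1_mulr1 : right_id pi1_one pi1_mul.
Proof. by elim/pi1_ind=> a; rewrite pi1_mulE gcatg1. Qed.
Lemma pi1_mulV : left_inverse pi1_one pi1_inv pi1_mul.
Proof.
by elim/pi1_ind=> a; rewrite pi1_invE pi1_mulE; apply/pi1_classP/req_gcatVg.
Qed.
Lemma pi1_mulrV : right_inverse pi1_one pi1_inv pi1_mul.
Proof.
elim/pi1_ind=> a; rewrite pi1_invE pi1_mulE; apply/pi1_classP.
by rewrite -{1}(grevK a); exact: req_gcatVg.
Qed.

HB.instance Definition _ :=
  isGroup.Build pi1 pi1_mulA pi1_mul1 pi1_mulr1 pi1_mulV pi1_mulrV.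

End Pi1.

Lemma req_map (r : nat) (G H : graph) (v w : G) (v' w' : H)
    (f : graph_hom G H) (fv : f v = v') (fw : f w = w') (phi psi : gpath v w) :
  req r phi psi -> req r (gpath_map fv fw phi) (gpath_map fv fw psi).
Proof.
have map_at (chi : gpath v w) i : gpath_map fv fw chi i = f (chi i) by [].
apply: (req_morph (F := gpath_map fv fw)) => {phi psi} a b.
- move=> [len [x xle [h1 h2]]]; split=> //; exists x => //.
  by split=> i ix; rewrite !map_at; [rewrite h1|rewrite h2].
- move=> B; apply: (condB_inj (g := id) B) => //=; first by case: B.
  by move=> i ile; rewrite !map_at => d; split=> // ab; apply: d; rewrite ab.
Qed.

Section Pi1Map.
Variables (G H : graph) (v : G) (w : H) (r : nat).
Variable f : based_hom v w.

Definition pi1_map (c : pi1 r v) : pi1 r w :=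
  pi1_class r (gpath_map (based_homE f) (based_homE f) (repr c)).

Lemma pi1_mapE (phi : gpath v v) :
  pi1_map (pi1_class r phi) =
  pi1_class r (gpath_map (based_homE f) (based_homE f) phi).
Proof. exact/pi1_classP/req_map/req_repr. Qed.

End Pi1Map.

Fixpoint nbhd (G : graph) (i : nat) (v : G) : set G :=
  if i is j.+1 then \bigcup_(w in nbhd j v) [set u | adj w u] else [set v].

Definition is_rcovering (r : nat) (G H : graph) (p : graph_hom G H) : Prop :=
  forall i, 1 <= i <= r -> forall v : G, set_bij (nbhd i v) (nbhd i (p v)) p.

Definition rcovering_of (r : nat) (G : graph) (v : G) (Gam : {pred pi1 r v})
    (E : graph) (e : E) (p : based_hom e v) : Prop :=
  [/\ is_rcovering r p, gconnected E & range (pi1_map (r := r) p) = [set` Gam]].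

(* Main.v *)
From HB Require Import structures.
Require Import Defs.
From mathcomp Require Import all_boot.
From Stdlib Require Import Relation_Operators.
From mathcomp Require Import all_classical zify.

(** This is covering space theory with one extra ingredient: a bridge between
    condition (B)_r and the injectivity of an r-covering on the sets N_d for
    d <= r.

    Two paths which differ in fewer than r places agree again within r steps
    of any place where they agree ([condB_gap]).  If their lifts coincide at
    one place of agreement, then at the next one the lifts both lie in a set
    N_d of the common point, with d <= r, over the same vertex, so they
    coincide there too ([lift_agree]).  Condition (A) only needs the
    injectivity on N_1.  Hence lifts, from a given point, of r-equivalent
    paths have the same end ([req_lift_end]).

    The usual lifting criterion follows ([lift_hom]): a homomorphism q from a
    connected based graph lifts through an r-covering p as soon as the image
    of q on pi_1^r is contained in that of p.  Two connected r-coverings with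
    the same image Gam thus map to each other over G, and these two maps are
    mutually inverse because lifts from a connected graph are determined by
    the image of one vertex ([lift_hom_uniq]).

    For the existence, the vertices over w are the paths from v to w, two
    paths phi and psi being identified when the loop going along phi and then
    back along psi has its class in Gam.  Extending paths makes every path
    from w to z act from the fiber over w to the fiber over z, and this
    action, [transport], depends only on the r-equivalence class.  The edges
    are the pairs of points related by the transport along an edge of G, so
    that a path of the covering always ends at the transport of its origin
    ([coset_monodromy]).  In the other direction, two paths of the same
    length d, with 0 < d <= r, and with the same ends differ in at most d - 1
    places ([condB_short]), so they act in the same way: this is the
    injectivity on N_d ([coset_rcovering]).  A path from v closes up to a loop
    at the base point exactly when its class belongs to Gam, which computes
    the image of the fundamental group ([coset_pi1_range]). *)

Set Implicit Arguments.
Unset Strict Implicit.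
Unset Printing Implicit Defensive.

Local Open Scope nat_scope.
Local Open Scope classical_set_scope.
Local Open Scope quotient_scope.

(** * Paths in a graph *)

Section Paths.
Variable G : graph.
Implicit Types u v w x y z : G.

Section Edge.
Variables (v w : G) (vw : adj v w).
Let f i := if i is 0 then v else w.

Lemma gedge_adj i : i < 1 -> adj (f i) (f i.+1).
Proof. by case: i. Qed.

Definition gedge : gpath v w := mk_gpath gedge_adj erefl erefl.

Lemma gedge1 : gedge 1 = w.
Proof. exact: mk_gpathE. Qed.
End Edge.

Lemma grev_gedge v w (vw : adj v w) : grev (gedge vw) = gedge (adj_sym vw).
Proof.
by apply: gpath_ext => // -[|[|//]] _; rewrite grevE //= ?subn0 ?subnn
  ?gedge1 ?gpath_at0.
Qed.

(** A path is an iterated extension of the constant path by edges; arguing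
    along this decomposition avoids subpaths, whose ends are not variables. *)
Lemma gpath_ind v (P : forall w, gpath v w -> Prop) :
  P v (gpath1 v) ->
  (forall w z (phi : gpath v w) (wz : adj w z),
     P w phi -> P z (gcat (gedge wz) phi)) ->
  forall w (phi : gpath v w), P w phi.
Proof.
move=> P1 PS w phi; have [n len] : exists n, plen phi = n by exists (plen phi).
elim: n w phi len => [|n IH] w phi len.
  have vw : v = w by rewrite -(gpath_at0 phi) -len gpath_at_len.
  case: w / vw phi len => phi len.
  rewrite (_ : phi = gpath1 v) //; apply: gpath_ext => // i.
  by rewrite len leqn0 => /eqP->; rewrite !gpath_at0.
have nw : adj (phi n) (phi n.+1) by apply: gpath_adj; lia.
have wE : phi n.+1 = w by rewrite -len gpath_at_len.
rewrite wE in nw.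
have preS i : i < n -> adj (phi i) (phi i.+1).
  by move=> ilt; apply: gpath_adj; lia.
pose pre := mk_gpath preS (gpath_at0 phi) (erefl (phi n)).
rewrite (_ : phi = gcat (gedge nw) pre); first exact/PS/IH.
apply: gpath_ext => /= [|i]; first by lia.
rewrite len leq_eqVlt => /orP[/eqP->|ile].
  by rewrite gcatr_sub /= ?subSnn ?gedge1 //; lia.
by rewrite gcatl //= mk_gpathE.
Qed.

Lemma grev_gcat u v w (psi : gpath v w) (phi : gpath u v) :
  grev (gcat psi phi) = gcat (grev phi) (grev psi).
Proof.
apply: gpath_ext => /= [|i ile]; first by lia.
rewrite grevE //=; have [h|h] := leqP i (plen psi).
  rewrite gcatr_sub; last by lia.
  by rewrite gcatl // grevE //; congr (psi _); lia.
rewrite gcatl; last by lia.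
by rewrite gcatr_sub /= ?grevE; [congr (phi _)|..]; lia.
Qed.

(** The cancellation which makes cosets of paths behave like cosets in a
    group: going along [alpha] and back does not matter, even in the middle of
    a path. *)
Lemma req_gcatKV r u v w z (psi : gpath v w) (alpha : gpath v z)
    (phi : gpath u v) :
  req r (gcat (gcat psi (grev alpha)) (gcat alpha phi)) (gcat psi phi).
Proof.
rewrite -gcatA; apply: req_gcatl; rewrite gcatA -[X in req _ _ X]gcat1g.
exact/req_gcatr/req_gcatVg.
Qed.

(** Every index strictly between [j] and [j + d] counts among the fewer than
    [r] differences, so a run of differences is shorter than [r]. *)
Lemma condB_gap r v w (phi psi : gpath v w) j d :
  condB r phi psi -> 0 < d -> j + d <= plen phi ->
  (forall k, j < k < j + d -> phi k <> psi k) -> d <= r.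
Proof.
move=> [_ rlt] d0 jd dif.
suff : d.-1 <= #|[pred i : 'I_(plen phi).+1 | `[< phi i <> psi i >]]| by lia.
pose h (k : 'I_d.-1) : 'I_(plen phi).+1 := inord (j + k.+1).
have hE k : nat_of_ord (h k) = j + k.+1.
  by rewrite inordK //; case: k => k /= kd; lia.
rewrite -{1}[d.-1]card_ord -(card_codom (f := h)); last first.
  move=> a b /(congr1 (@nat_of_ord _)); rewrite !hE => ab.
  by apply: val_inj => /=; lia.
apply: subset_leq_card; apply/fintype.subsetP => y /codomP[k ->].
by apply/asboolP; rewrite hE; apply: dif; case: k => k /= kd; lia.
Qed.

(** The two ends never count as differences, which leaves at most
    [plen phi - 1] of them. *)
Lemma condB_short r v w (phi psi : gpath v w) :
  0 < plen phi <= r -> plen phi = plen psi -> condB r phi psi.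
Proof.
move=> /andP[n0 nr] len; split=> //; apply: leq_trans nr.
have phi0 : phi 0 = psi 0 by rewrite !gpath_at0.
have phin : phi (plen phi) = psi (plen phi).
  by rewrite gpath_at_len len gpath_at_len.
have : [pred i : 'I_(plen phi).+1 | `[< phi i <> psi i >]]
    \subset [predC (pred2 ord0 ord_max)].
  apply/fintype.subsetP => i /asboolP di; rewrite !inE negb_or.
  by apply/andP; split; apply/eqP => ie; apply: di; rewrite ie.
move=> /subset_leq_card/leq_ltn_trans; apply.
have := cardC (pred2 (@ord0 (plen phi)) ord_max); rewrite card_ord card2.
have -> : (ord0 : 'I_(plen phi).+1) != ord_max.
  by apply/eqP => /(congr1 val) /=; lia.
by rewrite add2n => -[cardE]; exact: eq_leq.
Qed.

Lemma nbhd_adj x y : adj x y -> nbhd 1 x y.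
Proof. by move=> xy; exists x. Qed.

Lemma nbhd_gpath v w (phi : gpath v w) i d :
  i + d <= plen phi -> nbhd d (phi i) (phi (i + d)).
Proof.
elim: d => [|d IH] le; first by rewrite addn0.
exists (phi (i + d)); first by apply: IH; lia.
by rewrite addnS; apply: gpath_adj; lia.
Qed.

Lemma nbhdP d x y : nbhd d x y <-> exists phi : gpath x y, plen phi = d.
Proof.
split=> [|[phi <-]]; last first.
  have := @nbhd_gpath _ _ phi 0 (plen phi) (leqnn _).
  by rewrite add0n gpath_at0 gpath_at_len.
elim: d y => [|d IH] y /=; first by move=> ->; exists (gpath1 x).
by move=> [w /IH[phi len] wy]; exists (gcat (gedge wy) phi); rewrite /= len addn1.
Qed.

End Paths.

(** * Lifting paths *)

Section LiesOver.
Variables (E G : graph) (p : graph_hom E G).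

(** The ends of [phi] are independent indices, instead of [p x] and [p y]:
    a lift can then be compared with paths whose ends are only provably the
    images of [x] and [y]. *)
Definition lies_over (x y : E) (v w : G) (psi : gpath x y) (phi : gpath v w) :=
  plen psi = plen phi /\ forall i, i <= plen phi -> p (psi i) = phi i.

Lemma over_start x y v w (psi : gpath x y) (phi : gpath v w) :
  lies_over psi phi -> p x = v.
Proof. by move=> [_ /(_ 0 isT)]; rewrite !gpath_at0. Qed.

Lemma over_end x y v w (psi : gpath x y) (phi : gpath v w) :
  lies_over psi phi -> p y = w.
Proof. by move=> [len /(_ _ (leqnn _))]; rewrite -{1}len !gpath_at_len. Qed.

Lemma over_map x y v w (pv : p x = v) (pw : p y = w) (psi : gpath x y) :
  lies_over psi (gpath_map pv pw psi).
Proof. by []. Qed.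

Lemma over_mapE x y v w (pv : p x = v) (pw : p y = w) (psi : gpath x y)
    (phi : gpath v w) : lies_over psi phi -> gpath_map pv pw psi = phi.
Proof. by move=> [len h]; apply: gpath_ext => //= i; rewrite len => /h. Qed.

Lemma over_gpath1 x : lies_over (gpath1 x) (gpath1 (p x)).
Proof. by split=> //= i; rewrite leqn0 => /eqP->; rewrite !gpath_at0. Qed.

Lemma over_gedge x y (xy : adj x y) v w (vw : adj v w) :
  p x = v -> p y = w -> lies_over (gedge xy) (gedge vw).
Proof.
move=> pv pw; split=> // -[|[|//]] _; first by rewrite !gpath_at0.
by rewrite !gedge1.
Qed.

Lemma over_gcat x y z u v w (psi' : gpath y z) (psi : gpath x y)
    (phi' : gpath v w) (phi : gpath u v) :
  lies_over psi phi -> lies_over psi' phi' ->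
  lies_over (gcat psi' psi) (gcat phi' phi).
Proof.
move=> [len h] [len' h']; split=> [|i /= ile]; first by rewrite /= len len'.
have [il|ig] := leqP i (plen phi); first by rewrite !gcatl ?len // h.
by rewrite !gcatr_sub ?len ?len' ?h' //; lia.
Qed.

Lemma over_grev x y v w (psi : gpath x y) (phi : gpath v w) :
  lies_over psi phi -> lies_over (grev psi) (grev phi).
Proof.
move=> [len h]; split=> // i /= ile.
by rewrite !grevE ?len // h //; lia.
Qed.

Lemma hom_nbhd d x y : nbhd d x y -> nbhd d (p x) (p y).
Proof.
by move=> /nbhdP[phi <-]; apply/nbhdP; exists (gpath_map erefl erefl phi).
Qed.

(** Surjectivity on the sets of neighbours, isolated because it suffices to
    lift paths: it is what is known of the graph of cosets before the latter is
    shown to be an r-covering. *)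
Definition edge_lifting :=
  forall x u, adj (p x) u -> exists2 y, adj x y & p y = u.

Lemma lift_gpath x v w (phi : gpath v w) : edge_lifting -> p x = v ->
  exists y (psi : gpath x y), lies_over psi phi.
Proof.
move=> lift pv; elim/gpath_ind: phi => [|w' z phi wz [y [psi over]]].
  by exists x, (gpath1 x); rewrite -pv; exact: over_gpath1.
have py := over_end over.
have [|y' yy' py'] := lift y z; first by rewrite py.
exists y', (gcat (gedge yy') psi); apply: over_gcat over _.
exact: over_gedge.
Qed.

End LiesOver.

(** * Lifts through an r-covering *)

Section Covering.
Variables (E G : graph) (r : nat) (p : graph_hom E G).
Hypotheses (hr : 0 < r) (cov : is_rcovering r p).

Lemma rcovering_nbhd_inj d x y z : 0 < d <= r -> nbhd d x y -> nbhd d x z ->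
  p y = p z -> y = z.
Proof.
by move=> dr xy xz; have [_ inj _] := cov dr x; apply: inj; rewrite inE.
Qed.

Lemma rcovering_edge_lifting : edge_lifting p.
Proof.
move=> x u xu; have [|_ _ surj] := @cov 1 _ x; first by [].
have [|y xy <-] := surj u; first by exists (p x).
by exists y => //; case: xy => _ ->.
Qed.

(** Unique lifting by injectivity on [N_1].  The two segments may start at
    different indices, so that the part of a path after an inserted detour can
    be compared with the original one. *)
Lemma rcovering_lift_rigid x y x' y' (psi : gpath x y) (psi' : gpath x' y')
    a b m : a + m <= plen psi -> b + m <= plen psi' -> psi a = psi' b ->
  (forall d, d <= m -> p (psi (a + d)) = p (psi' (b + d))) ->
  psi (a + m) = psi' (b + m).
Proof.
move=> am bm ab; elim: m am bm => [|m IH] am bm pE; first by rewrite !addn0.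
have e : psi (a + m) = psi' (b + m).
  by apply: IH => [||d dm]; [lia|lia|apply: pE; lia].
apply: (rcovering_nbhd_inj (d := 1) (x := psi (a + m))); last exact: pE.
- by rewrite hr.
- by rewrite addnS; apply/nbhd_adj/gpath_adj; lia.
- by rewrite e addnS; apply/nbhd_adj/gpath_adj; lia.
Qed.

(** From the last agreement [j] before an index of agreement, both lifts reach
    that index in the same number of steps, at most [r] by [condB_gap]; as the
    lifts coincide at [j] by induction, injectivity on that neighbourhood
    applies. *)
Lemma lift_agree x y y' v w (phi phi' : gpath v w) (psi : gpath x y)
    (psi' : gpath x y') :
  condB r phi phi' -> lies_over p psi phi -> lies_over p psi' phi' ->
  forall i, i <= plen phi -> phi i = phi' i -> psi i = psi' i.
Proof.
move=> B [len pE] [len' pE']; elim/ltn_ind=> -[|n] IH ile phiE.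
  by rewrite !gpath_at0.
pose P j := `[< j <= n /\ phi j = phi' j >].
have exP : exists j, P j.
  by exists 0; apply/asboolP; rewrite !gpath_at0.
have boundP j : P j -> j <= n by move=> /asboolP[].
case: (ex_maxnP exP boundP) => j /asboolP[jn jE] maxj.
have lenB := B.1.
have dr : 0 < n.+1 - j <= r.
  apply/andP; split; first by lia.
  apply: (condB_gap (j := j) B) => [||k kj kE]; [lia|lia|].
  have kn : k <= n by lia.
  have /maxj : P k by apply/asboolP.
  by lia.
have nE : n.+1 = j + (n.+1 - j) by lia.
apply: (rcovering_nbhd_inj dr (x := psi j)).
- by have := @nbhd_gpath _ _ _ psi j (n.+1 - j); rewrite -nE; apply; lia.
- have -> : psi j = psi' j by apply: IH => //; lia.
  by have := @nbhd_gpath _ _ _ psi' j (n.+1 - j); rewrite -nE; apply; lia.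
- by rewrite pE // pE' -?lenB.
Qed.

(** Transitivity is the reason to quantify over all lifts inside the
    induction: the intermediate path is lifted from the same origin. *)
Lemma req_lift_end v w (phi phi' : gpath v w) : req r phi phi' ->
  forall x y y' (psi : gpath x y) (psi' : gpath x y'),
  lies_over p psi phi -> lies_over p psi' phi' -> y = y'.
Proof.
have stepB (a b : gpath v w) : condB r a b -> forall x y y'
    (psi : gpath x y) (psi' : gpath x y'),
    lies_over p psi a -> lies_over p psi' b -> y = y'.
  move=> B x y y' psi psi' over over'.
  have e := lift_agree B over over' (leqnn _).
  have [len _] := over; have [len' _] := over'; have lenB := B.1.
  rewrite -(gpath_at_len psi) -(gpath_at_len psi') len len' -lenB; apply: e.
  by rewrite {2}lenB !gpath_at_len.
elim=> {phi phi'} [a b [A|]|a|a b _ IH|a b c _ IHab _ IHbc] x y y' psi psi'.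
- move: A => [lenA [k kle [before after]]] [len pE] [len' pE'].
  have ek : psi' (0 + k) = psi (0 + k).
    apply: rcovering_lift_rigid => [||| d dk]; [lia|lia|by rewrite !gpath_at0|].
    by rewrite !add0n pE' ?pE ?before //; lia.
  rewrite !add0n in ek.
  (* Both ends of the detour are neighbours of its middle, over one vertex. *)
  have ek2 : psi' (k + 2) = psi k.
    rewrite -ek; apply: (rcovering_nbhd_inj (d := 1) (x := psi' k.+1)).
    + by rewrite hr.
    + by rewrite addn2; apply/nbhd_adj/gpath_adj; lia.
    + by apply/nbhd_adj/adj_sym/gpath_adj; lia.
    + by rewrite !pE' ?after ?before //; lia.
  rewrite -(gpath_at_len psi) -(gpath_at_len psi') len len' lenA.
  have -> : plen a + 2 = (k + 2) + (plen a - k) by lia.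
  rewrite -{1}(subnKC kle); apply/esym/rcovering_lift_rigid => [||| d dk]; [lia|lia|by []|].
  have -> : k + 2 + d = k + d + 2 by lia.
  by rewrite pE' ?pE ?after //; lia.
- exact: stepB.
- apply: stepB; split=> //; rewrite (_ : #|_| = 0) //.
  by apply: eq_card0 => i; rewrite inE; apply/asboolP; case.
- by move=> over over'; apply/esym; apply: IH over' over.
- move=> over over'.
  have [z [chi overb]] := lift_gpath b rcovering_edge_lifting (over_start over).
  by rewrite (IHab _ _ _ _ _ over overb); apply: IHbc overb over'.
Qed.

Lemma over_end_uniq v w x y y' (phi : gpath v w)
    (psi : gpath x y) (psi' : gpath x y') :
  lies_over p psi phi -> lies_over p psi' phi -> y = y'.
Proof. by apply: req_lift_end; apply: rst_refl. Qed.

(** The set of vertices where two lifts agree is closed under adjacency, by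
    injectivity on [N_1]. *)
Lemma lift_hom_uniq (F : graph) (e x : F) (f g : graph_hom F E) :
  gconnected F -> f e = g e -> (forall a, p (f a) = p (g a)) -> f x = g x.
Proof.
move=> /(_ e x)[alpha] fge pfg; elim/gpath_ind: alpha => // w z _ wz fgw.
apply: (rcovering_nbhd_inj (d := 1) (x := f w)) => //.
- exact/nbhd_adj/hom_adj.
- by rewrite fgw; exact/nbhd_adj/hom_adj.
Qed.

(** The value of the lift at [x] is the end of the lift of the image of any
    path [alpha] from [e'] to [x].  For another path [alpha'], the loop along
    [alpha] and back along [alpha'] has an image which is r-equivalent to that
    of a loop of [E]; so its lift is closed by [req_lift_end], and its second
    half is the reverse of a lift of the image of [alpha']. *)
Lemma lift_hom (F : graph) (e : E) (e' : F) (v : G) (q : graph_hom F G)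
    (pe : p e = v) (qe : q e' = v) : gconnected F ->
  range (pi1_map (r := r) (BasedHom qe)) `<=`
    range (pi1_map (r := r) (BasedHom pe)) ->
  exists f : based_hom e' e, forall x, p (f x) = q x.
Proof.
move=> conF sub.
pose R x y := exists (alpha : gpath e' x) (beta : gpath e y),
  lies_over p beta (gpath_map (erefl (q e')) (erefl (q x)) alpha).
have Rtotal x : exists y, R x y.
  have [alpha] := conF e' x.
  have [|y [beta over]] := lift_gpath (x := e)
    (gpath_map (erefl (q e')) (erefl (q x)) alpha) rcovering_edge_lifting.
    by rewrite pe.
  by exists y, alpha, beta.
have Rfun x y y' : R x y -> R x y' -> y = y'.
  move=> [alpha [beta over]] [alpha' [beta' over']].
  have [z [delta overd]] := lift_gpath
    (grev (gpath_map (erefl (q e')) (erefl (q x)) alpha'))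
    rcovering_edge_lifting (over_end over).
  have overl := over_gcat over overd.
  pose loop := gcat (grev alpha') alpha.
  have [|c _] := sub (pi1_class r (gpath_map qe qe loop)).
    by exists (pi1_class r loop) => //; rewrite pi1_mapE.
  elim/pi1_ind: c => gamma; rewrite pi1_mapE => /pi1_classP eq_loop.
  have ze : e = z.
    apply: (req_lift_end eq_loop (over_map pe pe gamma)
      (psi' := gcat delta beta)).
    have [len pE] := overl; split=> [|i ile]; first by rewrite len.
    rewrite pE //; apply/esym.
    have [_ h] := over_gcat (over_map (erefl (q e')) (erefl (q x)) alpha)
      (over_grev (over_map (erefl (q e')) (erefl (q x)) alpha')).
    exact: h.
  case: z / ze delta overd overl => delta overd _.
  by apply: over_end_uniq over'; rewrite -[gpath_map _ _ alpha']grevK;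
    exact: over_grev overd.
have [f fR] := choice Rtotal.
have pf x : p (f x) = q x by have [alpha [beta /over_end]] := fR x.
have f_adj x y : adj x y -> adj (f x) (f y).
  move=> xy; have [alpha [beta over]] := fR x.
  have pxy : adj (p (f x)) (q y) by rewrite pf; exact: hom_adj.
  have [z fxz pz] := rcovering_edge_lifting pxy.
  suff <- : z = f y by [].
  apply: Rfun (fR y); exists (gcat (gedge xy) alpha), (gcat (gedge fxz) beta).
  rewrite (_ : gpath_map _ _ _ = gcat (gedge (hom_adj q xy))
    (gpath_map (erefl (q e')) (erefl (q x)) alpha)).
    by apply: over_gcat over _; apply: over_gedge.
  apply: over_mapE; apply: over_gcat (over_map _ _ alpha) _.
  exact: over_gedge.
have fe : f e' = e.
  apply: Rfun (fR e') _; exists (gpath1 e'), (gpath1 e).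
  rewrite (_ : gpath_map _ _ _ = gpath1 (q e')); last exact/over_mapE/over_gpath1.
  by rewrite qe -pe; exact: over_gpath1.
by exists (@BasedHom F E e' e (GraphHom f_adj) fe).
Qed.

End Covering.

(** * The graph of cosets of paths *)

Section Construction.
Variables (G : graph) (r : nat) (v : G).
Variables (Gam : {pred pi1 r v}) (hGam : group_closed Gam).

Definition same_coset w : rel (gpath v w) :=
  fun phi psi => pi1_class r (gcat (grev psi) phi) \in Gam.

Lemma same_coset_refl w : reflexive (@same_coset w).
Proof.
move=> phi; rewrite /same_coset.
have /pi1_classP -> := req_gcatVg r phi.
exact: hGam.1.
Qed.

Lemma same_coset_sym w : symmetric (@same_coset w).
Proof.
suff h (phi psi : gpath v w) : same_coset phi psi -> same_coset psi phi.
  by move=> phi psi; apply/idP/idP; exact: h.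
move=> /(group_closedV hGam); rewrite /same_coset.
by rewrite [(_^-1)%g]pi1_invE grev_gcat grevK.
Qed.

Lemma same_coset_trans w : transitive (@same_coset w).
Proof.
move=> psi phi chi h k; rewrite /same_coset.
have := group_closedM hGam k h; rewrite [(_ * _)%g]pi1_mulE.
have := req_gcatKV r (grev chi) (grev psi) phi.
by rewrite grevK => /pi1_classP ->.
Qed.

Canonical same_coset_equiv w := EquivRel (@same_coset w) (@same_coset_refl w)
  (@same_coset_sym w) (@same_coset_trans w).

Definition fiber w : Type := {eq_quot (same_coset_equiv w)}.
HB.instance Definition _ w := Choice.on (fiber w).
HB.instance Definition _ w := EqQuotient.on (fiber w).

(** The coset of [phi] is the orbit of its r-class under precomposition with
    the loops whose class is in [Gam]. *)
Definition coset w (phi : gpath v w) : fiber w := \pi_(fiber w) phi.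

Lemma cosetP w (phi psi : gpath v w) :
  coset phi = coset psi <-> pi1_class r (gcat (grev psi) phi) \in Gam.
Proof.
split=> [/eqP|h]; first by rewrite /coset eqquotE.
by apply/eqP; rewrite /coset eqquotE.
Qed.

Lemma fiber_ind w (P : fiber w -> Prop) :
  (forall phi, P (coset phi)) -> forall c, P c.
Proof. by move=> h c; rewrite -[c]reprK; exact: h. Qed.

Lemma req_coset w (phi psi : gpath v w) :
  req r phi psi -> coset phi = coset psi.
Proof.
move=> h; apply/cosetP.
have /pi1_classP -> := req_gcatl (grev psi) h.
exact: same_coset_refl.
Qed.

(** The monodromy action of the paths of [G] on the fibers. *)
Definition transport w z (alpha : gpath w z) (c : fiber w) : fiber z :=
  coset (gcat alpha (repr c)).

Lemma transportE w z (alpha : gpath w z) (phi : gpath v w) :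
  transport alpha (coset phi) = coset (gcat alpha phi).
Proof.
have /cosetP h : coset (repr (coset phi)) = coset phi by exact: reprK.
apply/cosetP; rewrite grev_gcat.
by have /pi1_classP -> := req_gcatKV r (grev phi) alpha (repr (coset phi)).
Qed.

Lemma transport_gcat w y z (beta : gpath y z) (alpha : gpath w y) c :
  transport (gcat beta alpha) c = transport beta (transport alpha c).
Proof. by elim/fiber_ind: c => phi; rewrite !transportE gcatA. Qed.

Lemma transport_gpath1 w c : transport (gpath1 w) c = c.
Proof. by elim/fiber_ind: c => phi; rewrite transportE gcat1g. Qed.

Lemma req_transport w z (alpha beta : gpath w z) :
  req r alpha beta -> transport alpha = transport beta.
Proof.
move=> h; apply/funext => c; elim/fiber_ind: c => phi.
by rewrite !transportE; exact/req_coset/req_gcatr.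
Qed.

Definition coset_vertex : Type := {w : G & fiber w}.

Definition coset_adj (a b : coset_vertex) : Prop :=
  exists h : adj (tag a) (tag b), tagged b = transport (gedge h) (tagged a).

Lemma coset_adj_sym a b : coset_adj a b -> coset_adj b a.
Proof.
move=> [h hE]; exists (adj_sym h); rewrite hE.
rewrite -grev_gedge -transport_gcat (req_transport (req_gcatVg r _)).
by rewrite transport_gpath1.
Qed.

Definition coset_graph : graph := Graph coset_adj_sym.

Definition coset_point w (c : fiber w) : coset_graph := existT _ w c.

Lemma coset_projP (a b : coset_graph) : adj a b -> adj (tag a) (tag b).
Proof. by case. Qed.

Definition coset_proj : graph_hom coset_graph G := GraphHom coset_projP.

Lemma coset_edge_lifting : edge_lifting coset_proj.
Proof.
move=> [w c] u wu; exists (coset_point (transport (gedge wu) c)) => //.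
by exists wu.
Qed.

(** Edges of the graph of cosets are transports along edges of [G], and
    transport is functorial. *)
Lemma coset_monodromy (a b : coset_graph) (alpha : gpath a b) :
  tagged b = transport
    (gpath_map (erefl (coset_proj a)) (erefl (coset_proj b)) alpha) (tagged a).
Proof.
elim/gpath_ind: alpha => [|b' c alpha bc IH].
  by rewrite (over_mapE _ _ (over_gpath1 _ _)) transport_gpath1.
have [h hE] := bc; rewrite hE IH -transport_gcat; congr (transport _ _).
apply/esym/over_mapE/over_gcat; first exact: over_map.
exact: over_gedge.
Qed.

Lemma coset_lift w z (alpha : gpath w z) (c : fiber w) :
  exists psi : gpath (coset_point c) (coset_point (transport alpha c)),
    lies_over coset_proj psi alpha.
Proof.
have [|[z' d] [psi over]] := lift_gpath (x := coset_point c) alpha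
  coset_edge_lifting.
  by [].
have /= e := over_end over; case: z / e alpha over => alpha over.
have /= dE := coset_monodromy psi.
have aE := over_mapE (erefl _) (erefl _) over.
rewrite aE in dE.
by clear aE; subst d; exists psi.
Qed.

(** Homomorphisms preserve the sets [N_d], and path lifting gives their
    surjectivity, whatever [d].  The bound [d <= r] serves for injectivity:
    by [condB_short] the projections of two paths of length [d] from the same
    point to points over the same vertex are r-equivalent, hence transport in
    the same way. *)
Lemma coset_rcovering : is_rcovering r coset_proj.
Proof.
move=> d dr a; split.
- by move=> b; exact: hom_nbhd.
- move=> b b'; rewrite !inE => /nbhdP[alpha len] /nbhdP[alpha' len'] bb'.
  have cE := coset_monodromy alpha; have cE' := coset_monodromy alpha'.
  case: b b' => [z c] [z' c'] /= in bb' alpha alpha' len len' cE cE' *.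
  case: z' / bb' c' alpha' len' cE' => c' alpha' len' cE'.
  congr existT; rewrite cE cE'; congr (_ _).
  apply/req_transport/rst_step; right; apply: condB_short => /=.
    by rewrite len.
  by rewrite len'.
- move=> z /nbhdP[alpha len].
  have [|y [psi over]] := lift_gpath (x := a) alpha coset_edge_lifting.
    by [].
  exists y; last exact: over_end over.
  by apply/nbhdP; exists psi; rewrite over.1.
Qed.

Definition coset_base : coset_graph := coset_point (coset (gpath1 v)).

(** Transporting the class of the constant path along [phi] gives the class of
    [phi] itself: the points of the fibers name the ends of the lifts from the
    base point. *)
Lemma coset_lift_base w (phi : gpath v w) :
  exists psi : gpath coset_base (coset_point (coset phi)),
    lies_over coset_proj psi phi.
Proof.
have := coset_lift phi (coset (gpath1 v)).
by rewrite transportE gcatg1.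
Qed.

Lemma coset_connected : gconnected coset_graph.
Proof.
have path_to (a : coset_graph) : inhabited (gpath coset_base a).
  case: a => w c; elim/fiber_ind: c => phi.
  by have [psi _] := coset_lift_base phi.
by move=> a b; have [alpha] := path_to a; have [beta] := path_to b;
  constructor; exact: gcat beta (grev alpha).
Qed.

Definition coset_cover : based_hom coset_base v :=
  @BasedHom coset_graph G coset_base v coset_proj erefl.

Lemma coset_pi1_range : range (pi1_map (r := r) coset_cover) = [set` Gam].
Proof.
have in_Gam (phi : gpath v v) :
    pi1_class r phi \in Gam <-> coset phi = coset (gpath1 v).
  have rev1 : grev (gpath1 v) = gpath1 v by apply: gpath_ext.
  by rewrite cosetP rev1 gcat1g.
apply/seteqP; split=> [_ [c _ <-]|c].
  elim/pi1_ind: c => alpha; rewrite pi1_mapE /=; apply/in_Gam.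
  have /= := coset_monodromy alpha.
  by rewrite transportE gcatg1.
elim/pi1_ind: c => phi /in_Gam phi1.
have [psi over] := coset_lift_base phi.
rewrite phi1 in psi over.
by exists (pi1_class r psi) => //; rewrite pi1_mapE (over_mapE _ _ over).
Qed.

Lemma coset_coverP : rcovering_of Gam coset_cover.
Proof.
split; [exact: coset_rcovering|exact: coset_connected|exact: coset_pi1_range].
Qed.

End Construction.

Theorem theorem6p11 (r : nat) (hr : 0 < r) (G : graph) (v : G)
    (Gam : {pred pi1 r v}) (hGam : group_closed Gam) :
  (exists (E : graph) (e : E) (p : based_hom e v), rcovering_of Gam p) /\
  (forall (E1 E2 : graph) (e1 : E1) (e2 : E2)
          (p1 : based_hom e1 v) (p2 : based_hom e2 v),
     rcovering_of Gam p1 -> rcovering_of Gam p2 ->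
     exists f : based_hom e1 e2,
       is_graph_iso f /\ forall x : E1, p2 (f x) = p1 x).
Proof.
split.
  exists (coset_graph hGam), (coset_base hGam), (coset_cover hGam).
  exact: coset_coverP.
move=> E1 E2 e1 e2 [p1 pe1] [p2 pe2] [cov1 con1 ran1] [cov2 con2 ran2].
have [|f pf] := lift_hom hr cov2 (pe := pe2) (qe := pe1) con1; first by rewrite ran1 ran2.
have [|g pg] := lift_hom hr cov1 (pe := pe1) (qe := pe2) con2; first by rewrite ran1 ran2.
exists f; split=> //; exists g; split=> x.
- apply: (lift_hom_uniq hr cov1 x (f := hom_comp g f)
    (g := GraphHom (fun _ _ xy => xy)) (e := e1)) => //=.
    by rewrite !based_homE.
  by move=> a; rewrite pg pf.
- apply: (lift_hom_uniq hr cov2 x (f := hom_comp f g)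
    (g := GraphHom (fun _ _ xy => xy)) (e := e2)) => //=.
    by rewrite !based_homE.
  by move=> a; rewrite pf pg.
Qed.
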